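(* Let $0<\varepsilon<1$, let $a=a(n)$ be a positive integer (a function of $n$), and suppose that either $a=o\left(\sqrt{\frac{n}{\ln n}}\right)$ and $b=(1-\varepsilon)\frac{an}{a+\ln n}$, or $a=\Omega\left(\sqrt{\frac{n}{\ln n}}\right)$ and $b=(1-\varepsilon)n$ (rounding of $b$ to an integer being suppressed). Let $0<\delta<\min\left(\varepsilon,\frac{2^2}{e^7 10^4}\right)$ and $k_0=\delta^5 n$. Then in the $(a:b)$ Maker-Breaker game on the edges of $K_n$ with Breaker moving first, Maker has a randomized strategy such that, against any strategy of Breaker, Maker's graph is a $k_0$-expander after at most $\frac{16n}{a}$ moves of Maker with probability tending to $1$ as $n\to\infty$.
   Context: The $(a:b)$ Maker-Breaker game on the edges of $K_n$: in each round Breaker first claims $b$ previously unclaimed edges of the complete graph $K_n$ on $n$ vertices, then Maker claims $a$ previously unclaimed edges (if fewer edges remain, a player claims all remaining ones); one move of Maker consists of the $a$ edges he claims in one round. Maker's graph is the graph on the $n$ vertices formed by the edges claimed by Maker. For a graph $G=(V,E)$ and $U\subset V$, $N_G(U)=\{v\in V\setminus U: v\text{ has a neighbor in }U\}$. The graph $G$ is a $k_0$-expander if $|N_G(U)|\ge 2|U|$ for every $U\subset V$ with $|U|\le k_0$.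
   Formalization: When a > 16n the bound 16n/a is below 1, so Maker would have made no move and the claim fails (the empty graph is no expander); the formal theorem allows one move of Maker in that range, and is literal for a ≤ 16n. *)

(* Defs.v *)
From HB Require Import structures.
From mathcomp Require Import all_boot all_order all_algebra.
From mathcomp Require Import all_classical all_reals all_analysis.
Set Implicit Arguments.
Unset Strict Implicit.
Unset Printing Implicit Defensive.
Import Order.TTheory GRing.Theory Num.Theory.
Import numFieldNormedType.Exports.
Local Open Scope ring_scope.

Section MakerBreaker.
Variables (R : realType) (X : finType).

(* The rounds played so far, in chronological order; a round is the pair of
   (set claimed by Breaker, set claimed by Maker), Breaker moving first. *)
Definition history := seq ({set X} * {set X}).

Definition maker_claimed (h : history) : {set X} :=
  \bigcup_(r <- h) r.2.

Definition unclaimed (h : history) : {set X} :=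
  ~: \bigcup_(r <- h) (r.1 :|: r.2).

(* With bias m, a player claims m free elements, or all of them if fewer than
   m remain. *)
Definition legal_move (m : nat) (free A : {set X}) : bool :=
  (A \subset free) && (#|A| == minn m #|free|).

Definition breaker_strategy := history -> {set X}.

Definition is_breaker_strategy (b : nat) (beta : breaker_strategy) : Prop :=
  forall h, legal_move b (unclaimed h) (beta h).

(* [mu h B A] is the probability that Maker claims A, given the complete
   previous rounds h and Breaker's move B in the current round. *)
Definition maker_strategy := history -> {set X} -> {set X} -> R.

Definition is_maker_strategy (a : nat) (mu : maker_strategy) : Prop :=
  forall (h : history) (B : {set X}),
    [/\ forall A, 0 <= mu h B A,
        forall A, ~~ legal_move a (unclaimed h :\: B) A -> mu h B A = 0
      & \sum_(A : {set X}) mu h B A = 1].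

(* The probability that the history reached from h after t more rounds
   satisfies E. *)
Fixpoint play_prob (mu : maker_strategy) (beta : breaker_strategy)
    (t : nat) (h : history) (E : pred history) : R :=
  if t is t'.+1 then
    \sum_(A : {set X})
       mu h (beta h) A * play_prob mu beta t' (rcons h (beta h, A)) E
  else (E h)%:R.

End MakerBreaker.

Section Expander.
Variables (R : realType) (V : finType).

Definition nbhd_set (g : rel V) (U : {set V}) : {set V} :=
  [set v | (v \notin U) && [exists u in U, g u v]].

Definition expander (k0 : R) (g : rel V) : bool :=
  [forall U : {set V},
     (#|U|%:R <= k0) ==> (2 * #|U| <= #|nbhd_set g U|)%N].

End Expander.

Definition Kn_edge (n : nat) : finType := {e : {set 'I_n} | #|e| == 2}.

Definition graph_of (n : nat) (F : {set Kn_edge n}) : rel 'I_n :=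
  fun u v => [set u; v] \in [set val e | e in F].

Definition maker_expander_by (R : realType) (n : nat) (k0 : R) (T : nat) :
    pred (history (Kn_edge n)) :=
  fun h => [exists t : 'I_T.+1, expander k0 (graph_of (maker_claimed (take t h)))].

(* "At most 16n/a moves", i.e. at most the integer part of 16n/a.  For a > 16n
   that integer part is 0, when Maker has not moved yet; one move is then
   allowed. *)
Definition move_bound (n a : nat) : nat := maxn 1 ((16 * n) %/ a).

(* m is x rounded down or up to an integer. *)
Definition rounding_of (R : realType) (m : nat) (x : R) : Prop :=
  x - 1 < m%:R < x + 1.

(* Main.v *)
Require Import Defs.
From HB Require Import structures.
From mathcomp Require Import all_boot all_order all_algebra.
From mathcomp Require Import all_classical all_reals all_analysis.
From mathcomp Require Import zify ring lra.
Set Implicit Arguments.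
Unset Strict Implicit.
Unset Printing Implicit Defensive.
Import Order.TTheory GRing.Theory Num.Theory.
Import numFieldNormedType.Exports.
Local Open Scope classical_set_scope.
Local Open Scope ring_scope.

(** Maker can play deterministically, so the random choices of the usual proof
are derandomized by conditional expectations.

Maker treats every vertex [8] times: a treatment of [x] secures an edge [xw]
chosen among the pairs that Breaker has not claimed (possibly one that Maker
already owns).  Among the active vertices, those still due for treatment, he
picks one of largest danger [deg_B(v) - (2b/a) r(v)], where [r(v)] counts
treatments.  As in the box game, the total danger of any [j] active vertices
stays at most [2 (b/a) j (H_n - H_j)] between rounds; for sets of at most
[k = eta n] vertices this is sharpened by counting an edge inside the set once,
which halves Breaker's gain, and yields
[deg_B(x) <= (b/a) ln n + b + eta n + o(n) <= (1 - delta) n]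
whenever an active [x] is treated.

Given this, [w] ranges over at least [delta n] vertices.  The potential sums,
over pairs [(U, S)] with [|S| = 3|U|] and [|U| <= delta^5 n] such that all
Maker edges at [U] end in [S], the quantity [(3|U| / (delta n))^m], with [m]
the number of treatments still due to [U]: the probability that random
treatments would keep the pair alive.  Its average over [w] does not increase,
so some [w] does not increase it.  It starts below [1], and once all
treatments are done it counts the obstructions to expansion, so there are
none. *)

(** * Degrees and touching edges in subsets of the edges of the complete graph *)

Lemma sum_pred_card (T : finType) (B : {set T}) (P : pred T) :
  (\sum_(e in B) P e)%N = #|[set e in B | P e]%SET|.
Proof.
rewrite -sum1_card big_mkcond [RHS]big_mkcond; apply: eq_bigr => e _.
by rewrite inE; case: (e \in B) => //=; case: (P e).
Qed.

Section EdgeCounts.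
Local Open Scope set_scope.
Variable n : nat.
Local Notation V := 'I_n.
Local Notation E := (Kn_edge n).
Implicit Types (B A : {set E}) (J : {set V}) (x : V).

Definition edge_deg B x : nat := \sum_(e in B) (x \in val e).

Definition edge_touch B J : nat := \sum_(e in B) ~~ [disjoint val e & J].

Lemma set2_injr x (y z : V) : x != y -> [set x; y] = [set x; z] -> y = z.
Proof.
move=> xy eq2; have : y \in [set x; z] by rewrite -eq2 finset.set22.
by rewrite !inE eq_sym (negPf xy) => /eqP.
Qed.

Lemma edge_pairP (e : E) x : x \in val e ->
  exists2 y, x != y & val e = [set x; y].
Proof.
have /cards2P[y [z [yz ->]]] := valP e.
rewrite !inE; case/orP => /eqP ->; first by exists z.
by exists y; [rewrite eq_sym|rewrite finset.setUC].
Qed.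

Lemma edge_of_pair x (y : V) : x != y -> exists e : E, val e = [set x; y].
Proof.
move=> xy; have xyP : #|[set x; y]| == 2 by rewrite cards2 xy.
by exists (exist _ [set x; y] xyP).
Qed.

Lemma card_edge_inter (e : E) J : (\sum_(v in J) (v \in val e) = #|val e :&: J|)%N.
Proof.
by rewrite -sum1_card big_mkcond [RHS]big_mkcond; apply: eq_bigr => v _;
  rewrite inE andbC; case: (v \in J) => //=; case: (v \in val e).
Qed.

Lemma edge_touch_le B J : (edge_touch B J <= \sum_(v in J) edge_deg B v)%N.
Proof.
rewrite exchange_big; apply: leq_sum => e _.
rewrite card_edge_inter -finset.setI_eq0; case: eqP => //= /eqP.
by rewrite -card_gt0.
Qed.

Lemma edge_touch1 B x : edge_touch B [set x] = edge_deg B x.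
Proof. by apply: eq_bigr => e _; rewrite disjoint_sym disjoints1 negbK. Qed.

(** A new edge counts once here but up to twice in [sum_edge_degU]. This difference is the halving
    of Breaker's gain on small sets. *)
Lemma edge_touchU B A J : (edge_touch (B :|: A) J <= edge_touch B J + #|A|)%N.
Proof.
rewrite /edge_touch -sum1_card big_mkcond /= (big_mkcond (mem B)) (big_mkcond (mem A)).
rewrite -big_split; apply: leq_sum => e _ /=; rewrite !inE.
by case: (e \in B); case: (e \in A); case: (~~ _).
Qed.

Lemma sum_edge_degU B A J :
  (\sum_(v in J) edge_deg (B :|: A) v <= \sum_(v in J) edge_deg B v + 2 * #|A|)%N.
Proof.
rewrite exchange_big [X in (_ <= X + _)%N]exchange_big /= -sum1_card big_distrr /=.
rewrite big_mkcond /= (big_mkcond (mem B)) (big_mkcond (mem A)).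
rewrite -big_split; apply: leq_sum => e _ /=; rewrite !inE.
have : (\sum_(v in J) (v \in val e) <= 2)%N.
  rewrite card_edge_inter -[leqRHS](eqP (valP e)).
  by apply/subset_leq_card/finset.subsetIl.
by case: (e \in B); case: (e \in A) => /=; lia.
Qed.

Lemma card_edges_between B x J : x \notin J ->
  (\sum_(e in B) ((x \in val e) && ~~ [disjoint val e & J]) <= #|J|)%N.
Proof.
move=> xJ; pose D := [set e in B | (x \in val e) && ~~ [disjoint val e & J]].
rewrite sum_pred_card -/D -(card_imset (mem D) val_inj).
apply: leq_trans (leq_imset_card (fun y => [set x; y]) J).
apply/subset_leq_card/fintype.subsetP => _ /imsetP[e + ->].
rewrite inE => /andP[_ /andP[xe /pred0Pn[y /andP[/= ye yJ]]]].
have [z xz ez] := edge_pairP xe; apply/imsetP; exists y => //.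
move: ye; rewrite ez !inE => /orP[/eqP yx|/eqP -> //].
by rewrite -yx yJ in xJ.
Qed.

(** The edges counted twice on the left are those joining [x] to [J], at most one for each vertex of
    [J]. *)
Lemma edge_touchU1 B x J : x \notin J ->
  (edge_touch B J + edge_deg B x <= edge_touch B (x |: J) + #|J|)%N.
Proof.
move=> xJ; apply: leq_trans (leq_add (leqnn _) (card_edges_between B xJ)).
rewrite -!big_split /=; apply: leq_sum => e _.
have -> : [disjoint val e & x |: J]%B = (x \notin val e) && [disjoint val e & J].
  by rewrite -[LHS]finset.setI_eq0 finset.setIUr finset.setU_eq0
    (finset.setIC _ [set x]) !finset.setI_eq0 disjoints1.
by case: (x \in val e); case: [disjoint val e & J]%B.
Qed.

Definition non_nbrs B x : {set V} := [set w | (w != x) && ~~ graph_of B x w].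

Lemma card_non_nbrs B x : (n <= #|non_nbrs B x| + edge_deg B x + 1)%N.
Proof.
pose N := [set w | graph_of B x w & w != x].
have cN : (#|N| <= edge_deg B x)%N.
  pose D := [set e in B | x \in val e].
  rewrite /edge_deg sum_pred_card -/D -(card_imset (mem D) val_inj) -(@card_in_imset _ _ (fun w => [set x; w])).
    apply/subset_leq_card/fintype.subsetP => _ /imsetP[w + ->].
    rewrite inE => /andP[/imsetP[e eB ew] _]; apply/imsetP; exists e => //.
    by rewrite inE eB -ew finset.set21.
  move=> w w'; rewrite !inE => /andP[_ wx] _.
  by apply: set2_injr; rewrite eq_sym.
have nE : #|non_nbrs B x :|: (N :|: [set x])| = n.
  rewrite -[RHS](card_ord n); apply: eq_card => w; rewrite !inE.
  by case: eqP => //= _; case: graph_of.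
apply: (@leq_trans #|non_nbrs B x :|: (N :|: [set x])|); first by rewrite nE.
apply: leq_trans (leq_card_setU _ _) _; rewrite -addnA leq_add2l.
by apply: leq_trans (leq_card_setU _ _) _; rewrite cards1 leq_add2r.
Qed.

End EdgeCounts.

(** * Box-game bounds on the danger of sets of active vertices *)

Section Danger.
Local Open Scope set_scope.
Variables (R : realType) (n d k : nat) (beta c : R).
Hypotheses (beta_ge0 : 0 <= beta) (c_ge0 : 0 <= c) (k_gt0 : (0 < k)%N)
  (kn : (k <= n)%N).
Local Notation V := 'I_n.
Local Notation E := (Kn_edge n).
Implicit Types (B A : {set E}) (J : {set V}) (x : V) (r : V -> nat).

Definition harm m : R := \sum_(i < m) i.+1%:R^-1.

Lemma harmS m : harm m.+1 = harm m + m.+1%:R^-1.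
Proof. by rewrite /harm big_ord_recr. Qed.

Lemma harm_le i j : (i <= j)%N -> harm i <= harm j.
Proof.
move=> /subnK <-; elim: (j - i)%N => [|m IH]; first by rewrite add0n.
by rewrite addSn harmS (le_trans IH)// lerDl invr_ge0 ler0n.
Qed.

Definition active r : {set V} := [set v | (r v < d)%N].

Definition treat r x : V -> nat := fun v => (r v + (v == x))%N.

Definition danger B r v : R := (edge_deg B v)%:R - 2 * beta * (r v)%:R.

Definition touch_danger B r J : R :=
  (edge_touch B J)%:R - \sum_(v in J) 2 * beta * (r v)%:R.

Definition danger_bound (j : nat) : R := j%:R * (2 * beta * (harm n - harm j)).

(* [c] absorbs, at size [k], the gap between the credits [2 * beta * t] and
   [beta * t] of the two invariants; below size [k], each step from [j + 1] to
   [j] costs [1] for the edges joining the treated vertex to the set. *)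
Definition touch_bound (j : nat) : R :=
  j%:R * (beta * (harm k - harm j) + (k%:R - j%:R)
          + 2 * beta * (harm n - harm k) + c).

(* [t] counts the edges Maker has yet to claim in the current round; the credit
   [2 * beta * t] is what is left of Breaker's gain in that round. *)
Definition danger_ok (t : nat) B r : Prop := forall J, (0 < #|J|)%N ->
  J \subset active r ->
  \sum_(v in J) danger B r v <= danger_bound #|J| + 2 * beta * t%:R /\
  ((#|J| <= k)%N -> touch_danger B r J <= touch_bound #|J| + beta * t%:R).

Lemma touch_danger_le B r J : touch_danger B r J <= \sum_(v in J) danger B r v.
Proof.
by rewrite sumrB lerB// -natr_sum ler_nat edge_touch_le.
Qed.

Lemma touch_dangerU1 B r J x : x \notin J ->
  touch_danger B r J + danger B r x <= touch_danger B r (x |: J) + #|J|%:R.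
Proof.
move=> xJ; rewrite /touch_danger /danger big_setU1//=.
have := edge_touchU1 B xJ; rewrite -(ler_nat R) !natrD; lra.
Qed.

Lemma active_treat r x : active (treat r x) \subset active r.
Proof.
by apply/fintype.subsetP => v; rewrite !inE; apply: leq_ltn_trans; rewrite leq_addr.
Qed.

Lemma danger_treat B r x v :
  danger B (treat r x) v = danger B r v - 2 * beta * (v == x)%:R.
Proof. by rewrite /danger /treat natrD; ring. Qed.

Lemma sum_danger_treat B r x J : \sum_(v in J) danger B (treat r x) v =
  \sum_(v in J) danger B r v - 2 * beta * (x \in J)%:R.
Proof.
under eq_bigr do rewrite danger_treat.
rewrite sumrB -mulr_sumr; congr (_ - _ * _).
have [xJ|xJ] := boolP (x \in J).
  by rewrite (bigD1 x)//= eqxx big1 ?addr0// => v /andP[_ /negPf ->].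
by rewrite big1// => v vJ; case: eqP => // vx; rewrite -vx vJ in xJ.
Qed.

Lemma touch_danger_treat B r x J : touch_danger B (treat r x) J =
  touch_danger B r J - 2 * beta * (x \in J)%:R.
Proof.
have := sum_danger_treat B r x J.
rewrite /touch_danger /danger !sumrB; lra.
Qed.

Lemma danger_ok0 : danger_ok 0 finset.set0 (fun=> 0%N).
Proof.
move=> J J0 _; have Jn : (#|J| <= n)%N by rewrite -[leqRHS]card_ord max_card.
have harmJ := harm_le Jn; have harmk := harm_le kn.
have deg0 v : edge_deg (finset.set0 : {set E}) v = 0%N by rewrite /edge_deg finset.big_set0.
split=> [|Jk].
  rewrite big1 => [|v _]; last by rewrite /danger deg0 !mulr0 subr0.
  by rewrite mulr0 addr0 !mulr_ge0 ?subr_ge0.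
rewrite /touch_danger /edge_touch finset.big_set0 big1 => [|v _]; last by rewrite mulr0.
have h1 : 0 <= beta * (harm k - harm #|J|) by rewrite mulr_ge0 ?subr_ge0 ?harm_le.
have h2 : 0 <= 2 * beta * (harm n - harm k) by rewrite !mulr_ge0 ?subr_ge0.
have h3 : #|J|%:R <= k%:R :> R by rewrite ler_nat.
rewrite mulr0 addr0 subr0; apply: mulr_ge0 => //.
by apply: addr_ge0 => //; apply: addr_ge0 => //; apply: addr_ge0; rewrite ?subr_ge0.
Qed.

Lemma danger_ok_breaker a B A r : #|A|%:R <= beta * a%:R ->
  danger_ok 0 B r -> danger_ok a (B :|: A) r.
Proof.
move=> Aa ok J J0 Jr; have [ok1 ok2] := ok J J0 Jr; split.
  move: ok1; rewrite /danger !sumrB -!natr_sum.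
  have := sum_edge_degU B A J; rewrite -(ler_nat R) natrD natrM; lra.
move=> Jk; have := ok2 Jk; rewrite /touch_danger.
have := edge_touchU B A J; rewrite -(ler_nat R) natrD; lra.
Qed.

(* Covers treatments through an edge Maker already owns: they use no claim. *)
Lemma danger_ok_free_treat t B r x : danger_ok t B r -> danger_ok t B (treat r x).
Proof.
move=> ok J J0 Jr; have [ok1 ok2] := ok J J0 (fintype.subset_trans Jr (active_treat r x)).
have b0 : 0 <= 2 * beta * (x \in J)%:R by rewrite !mulr_ge0.
rewrite sum_danger_treat touch_danger_treat; split=> [|/ok2]; lra.
Qed.

(** If [x] lies in [J], the treatment lowers the danger by [2 * beta], which pays for the spent
    credit. Otherwise [x] is at least as dangerous as the average of [J], so the invariant for
    [x |: J] passes to [J] by averaging; the term [1 / (j + 1)] that separates [harm j] from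
    [harm j.+1] pays for the spent credit. *)
Lemma danger_ok_treat t B r x : beta * t.+1%:R <= k%:R * c -> x \in active r ->
  (forall v, v \in active r -> danger B r v <= danger B r x) ->
  danger_ok t.+1 B r -> danger_ok t B (treat r x).
Proof.
move=> tc xr xmax ok J J0 Jbr; have b0 := beta_ge0.
have Jr := fintype.subset_trans Jbr (active_treat r x).
have [ok1 ok2] := ok J J0 Jr.
rewrite sum_danger_treat touch_danger_treat; have [xJ|xJ] := boolP (x \in J).
  by move: ok1 ok2; rewrite -(natr1 t) mulr1 => ok1 ok2; split=> [|/ok2 {}ok2]; lra.
rewrite !mulr0 !subr0.
set j := #|J| in J0 ok1 ok2 *.
have cardx : #|x |: J| = j.+1 by rewrite cardsU1 xJ.
have [] := ok (x |: J); rewrite ?cardx//.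
  by rewrite finset.subUset finset.sub1set xr.
have jpos : 0 < j%:R :> R by rewrite ltr0n.
have avg : \sum_(v in J) danger B r v <= j%:R * danger B r x.
  rewrite mulr_natl -sumr_const; apply: ler_sum => v vJ.
  exact/xmax/(fintype.subsetP Jr).
have t0 : 0 <= beta * t%:R by rewrite mulr_ge0.
have hS : j.+1%:R * j.+1%:R^-1 = 1 :> R by rewrite divff.
rewrite big_setU1//= /danger_bound /touch_bound harmS -(natr1 j) -(natr1 t).
move: hS; rewrite -(natr1 j); set i := (_ + 1)^-1 => hS.
have hSb : beta * ((j%:R + 1) * i) = beta by rewrite hS mulr1.
set F := \sum_(v in J) _ in avg ok1 *.
move=> ok1x ok2x.
(* By [avg], [F] is at most the share [j / (j + 1)] of the total danger of [x |: J]. *)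
have FE : F <= j%:R * (2 * beta * (harm n - harm j)) + 2 * beta * t%:R.
  have jF : (j%:R + 1) * F <= j%:R * (danger B r x + F) by lra.
  have : (j%:R + 1) * F <= j%:R * ((j%:R + 1) *
      (2 * beta * (harm n - harm j)) + 2 * beta * t%:R).
    apply: le_trans jF _; rewrite ler_pM2l//; apply: le_trans ok1x _.
    lra.
  move=> h; rewrite -(@ler_pM2l _ (j%:R + 1)) ?addr_gt0//; apply: le_trans h _.
  have : 0 <= 2 * beta * t%:R by rewrite !mulr_ge0.
  move: (2 * beta * t%:R) (2 * beta * _) => u w u0; lra.
split=> // jk.
(* At [j = k] the touching bound is inherited from the degree sum, and [tc] covers the excess
   [beta * t] of credit. *)
case: (ltngtP j k) jk => // [jk|jk] _; last first.
  apply: le_trans (touch_danger_le B r J) _; apply: le_trans FE _.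
  rewrite -jk !subrr mulr0 !add0r jk; move: tc; rewrite -natr1; lra.
have := ok2x jk; have := touch_dangerU1 B r xJ; rewrite -/j.
have := touch_danger_le B r J; rewrite -/F.
move: (touch_danger B r J) (touch_danger B r (x |: J)) => T T' TF TT T'le.
rewrite -(@ler_pM2l _ (j%:R + 1)) ?addr_gt0//.
(* This combines [T <= j * danger x] with the overlap bound [T + danger x <= T' + j]. The extra [j]
   is absorbed because [k - j] exceeds [k - (j + 1)] by one. *)
have TT2 : (j%:R + 1) * T <= j%:R * (T' + j%:R).
  have : T <= j%:R * danger B r x by lra.
  by have := ler_wpM2l (ltW jpos) TT; lra.
apply: le_trans TT2 _.
set Y := 2 * beta * (harm n - harm k) + c.
have {}T'le : T' <= (j%:R + 1) *
    (beta * (harm k - harm j) + (k%:R - j%:R - 1) + Y) + beta * t%:R.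
  by apply: le_trans T'le _; rewrite /Y; lra.
have := ler_wpM2l (ltW jpos) T'le.
rewrite /Y; lra.
Qed.

(** For a singleton the touching edges are the degree, and an active vertex has had fewer than [d]
    treatments, so its danger is close to its degree. *)
Lemma danger_ok_deg a t B r x : (t <= a)%N -> x \in active r -> danger_ok t B r ->
  (edge_deg B x)%:R <= touch_bound 1 + beta * a%:R + 2 * beta * d%:R.
Proof.
move=> ta xr ok; have [] := ok [set x]; rewrite ?cards1 ?finset.sub1set// => _ /(_ k_gt0).
rewrite /touch_danger edge_touch1 big_set1.
have : beta * t%:R <= beta * a%:R by rewrite ler_wpM2l// ler_nat.
have : 2 * beta * (r x)%:R <= 2 * beta * d%:R.
  by rewrite ler_wpM2l ?mulr_ge0// ler_nat ltnW//; move: xr; rewrite inE.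
lra.
Qed.

End Danger.

(** * Sets of prescribed size and binomial estimates *)

Lemma ex_card_between (T : finType) (A B : {set T}) m : A \subset B ->
  (#|A| <= m <= #|B|)%N ->
  exists S : {set T}, [/\ A \subset S, S \subset B & #|S| = m].
Proof.
move=> AB /andP[Am mB].
have : (m - #|A| <= #|B :\: A|)%N.
  by rewrite cardsD (finset.setIidPr AB) leq_sub2r.
move=> /card_geqP[s [us sm sBA]]; exists (A :|: [set z in s])%SET; split.
- exact: finset.subsetUl.
- rewrite finset.subUset AB; apply/fintype.subsetP => z; rewrite inE => /sBA.
  by rewrite inE => /andP[].
- rewrite cardsU (_ : A :&: _ = finset.set0); last first.
    apply/finset.setP => z; rewrite !inE; apply/negP => /andP[zA /sBA].
    by rewrite inE zA.
  by rewrite cards0 subn0 cardsE (card_uniqP us) sm subnKC.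
Qed.

Section BinomialBounds.
Local Open Scope nat_scope.

Lemma bin_le_exp2 m j : 'C(m, j) <= 2 ^ m.
Proof.
rewrite -[m in X in X <= _]card_ord -card_draws.
by apply: leq_trans (max_card _) _; rewrite -cardsT -powersetT card_powerset cardsT card_ord.
Qed.

(* Compare the central binomial coefficient 'C(2j, j) with 4^j. *)
Lemma exp_self_le_fact j : j ^ j <= 4 ^ j * j`!.
Proof.
apply: (@leq_trans ((2 * j) ^_ j)).
  rewrite ffact_prod (_ : j ^ j = \prod_(i < j) j); last by rewrite prod_nat_const card_ord.
  by apply: leq_prod => i _; have := ltn_ord i; lia.
by rewrite -bin_ffact leq_mul2r (_ : 4 = 2 ^ 2)// -expnM bin_le_exp2 orbT.
Qed.

(** This is the usual bound on binomial coefficients with 4 in place of e, free of division. *)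
Lemma bin_exp_le m j : 'C(m, j) * j ^ j <= (4 * m) ^ j.
Proof.
apply: leq_trans (leq_mul (leqnn _) (exp_self_le_fact j)) _.
rewrite mulnCA bin_ffact expnMn leq_mul2l ffact_prod.
rewrite (_ : m ^ j = \prod_(i < j) m); last by rewrite prod_nat_const card_ord.
apply/orP; right.
by apply: leq_prod => i _; rewrite leq_subr.
Qed.

End BinomialBounds.

(** * The potential of closed pairs and its behaviour under one treatment *)

Section Potential.
Local Open Scope set_scope.
Variables (R : realType) (n d : nat) (p k0 : R).
Hypotheses (p_gt0 : 0 < p) (n_gt0 : (0 < n)%N).
Local Notation V := 'I_n.
Local Notation E := (Kn_edge n).
Implicit Types (M B : {set E}) (U S : {set V}) (P : {set V} * {set V})
  (x w : V) (r : V -> nat).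

Definition closed_pair M P : bool :=
  [forall u in P.1, forall w, graph_of M u w ==> (w \in P.2)].

Definition small_pair P : bool :=
  [&& (0 < #|P.1|)%N, #|P.1|%:R <= k0 & #|P.2| == (3 * #|P.1|)%N].

(** It bounds the chance that a uniform choice among at least [p * n] candidates falls into a set of
    [3 * j] vertices. *)
Definition hit_prob (j : nat) : R := (3 * j)%:R / (p * n%:R).

Definition pair_weight M r P : R :=
  (closed_pair M P)%:R * hit_prob #|P.1| ^+ (\sum_(u in P.1) (d - r u)).

Definition potential M r : R := \sum_(P | small_pair P) pair_weight M r P.

(** Taking all edges with value [[set x; w]] makes this total: nothing is added when [x = w]. *)
Definition claim_pair M x w : {set E} := M :|: [set e | val e == [set x; w]].

Lemma graph_ofS M M' x w : M \subset M' -> graph_of M x w -> graph_of M' x w.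
Proof.
rewrite /graph_of => /fintype.subsetP MM' /imsetP[e eM ->].
by apply/imsetP; exists e => //; apply: MM'.
Qed.

Lemma closed_pairS M M' P : M \subset M' -> closed_pair M' P -> closed_pair M P.
Proof.
move=> MM' /forall_inP cl; apply/forall_inP => u uU; apply/forallP => w.
have /forallP/(_ w)/implyP cw := cl _ uU; apply/implyP => g.
exact/cw/(graph_ofS MM').
Qed.

Lemma closed_pair_claim M P x w : w != x -> x \in P.1 ->
  closed_pair (claim_pair M x w) P -> w \in P.2.
Proof.
move=> wx xU /forall_inP/(_ _ xU)/forallP/(_ w)/implyP; apply.
have [|e ew] := @edge_of_pair n x w; first by rewrite eq_sym.
by apply/imsetP; exists e => //; rewrite !inE; apply/orP; right; apply/eqP.
Qed.

Lemma hit_prob_ge0 j : 0 <= hit_prob j.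
Proof. by rewrite divr_ge0// mulr_ge0// ltW. Qed.

Lemma potentialS M M' r : M \subset M' -> potential M' r <= potential M r.
Proof.
move=> MM'; apply: ler_sum => P _; rewrite ler_wpM2r ?exprn_ge0 ?hit_prob_ge0//.
by rewrite ler_nat; have := @closed_pairS M M' P MM'; case: closed_pair => // ->.
Qed.

(** If [x] is outside [U], the exponent is unchanged and closedness can only be lost. If [x] is in
    [U], only choices [w] in [S] keep the pair closed; they form a share of at most [hit_prob #|U|]
    of the candidates, which matches the factor lost from the weight. *)
Lemma sum_pair_weight_le M B r x P : (r x < d)%N -> small_pair P ->
  p * n%:R <= #|non_nbrs B x|%:R ->
  \sum_(w in non_nbrs B x) pair_weight (claim_pair M x w) (treat r x) P
    <= #|non_nbrs B x|%:R * pair_weight M r P.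
Proof.
case: P => U S rx /and3P[/= U0 _ /eqP US] Cn; set C := non_nbrs B x.
have MMw w : M \subset claim_pair M x w by rewrite finset.subsetUl.
have [xU|xU] := boolP (x \in U); last first.
  have -> : #|C|%:R * pair_weight M r (U, S) =
      \sum_(w in C) pair_weight M r (U, S) by rewrite sumr_const mulr_natl.
  apply: ler_sum => w _; rewrite /pair_weight /=.
  have -> : (\sum_(u in U) (d - treat r x u) = \sum_(u in U) (d - r u))%N.
    apply: eq_bigr => u uU; rewrite /treat; case: eqP => [ux|]; last by rewrite addn0.
    by rewrite -ux uU in xU.
  rewrite ler_wpM2r ?exprn_ge0 ?hit_prob_ge0// ler_nat.
  by have := @closed_pairS _ _ (U, S) (MMw w); case: closed_pair => // ->.
set m := (\sum_(u in U) (d - treat r x u))%N.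
have mE : (\sum_(u in U) (d - r u) = m.+1)%N.
  rewrite /m (bigD1 x)//= [in RHS](bigD1 x)//= /treat eqxx -addSn; congr (_ + _)%N.
    by lia.
  by apply: eq_bigr => u /andP[_ /negPf ->]; rewrite addn0.
rewrite /pair_weight /= mE -/m -mulr_suml exprS !mulrA ler_wpM2r//.
  by rewrite exprn_ge0// hit_prob_ge0.
apply: (@le_trans _ _ ((closed_pair M (U, S))%:R * #|S|%:R)).
  case: (boolP (closed_pair M (U, S))) => cl; last first.
    rewrite mul0r big1// => w _; case: (boolP (closed_pair (claim_pair _ _ _) _)) => // cl'.
    by rewrite (closed_pairS (MMw w) cl') in cl.
  rewrite mul1r -natr_sum ler_nat sum_pred_card; apply/subset_leq_card/fintype.subsetP => w.
  rewrite !inE => /andP[/andP[wx _]]; exact: closed_pair_claim.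
rewrite [leRHS](_ : _ = (closed_pair M (U, S))%:R *
    (#|C|%:R * hit_prob #|U|)); last by rewrite /hit_prob; ring.
apply: ler_wpM2l; first by [].
rewrite US /hit_prob mulrCA ler_peMr// ler_pdivlMr ?mul1r//.
by rewrite mulr_gt0// ltr0n.
Qed.

Lemma potential_step M B r x : (r x < d)%N -> p * n%:R <= #|non_nbrs B x|%:R ->
  exists2 w, w \in non_nbrs B x &
    potential (claim_pair M x w) (treat r x) <= potential M r.
Proof.
move=> rx Cn; have C0 : 0 < #|non_nbrs B x|%:R :> R.
  by apply: lt_le_trans Cn; rewrite mulr_gt0// ltr0n.
apply: contrapT => noC.
have : \sum_(w in non_nbrs B x) potential (claim_pair M x w) (treat r x)
    <= \sum_(w in non_nbrs B x) potential M r.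
  rewrite exchange_big sumr_const -mulr_natl mulr_sumr.
  by apply: ler_sum => P sP; exact: sum_pair_weight_le.
apply/negP; rewrite -ltNge; apply: ltr_sum => [|w wC].
  by move: C0; rewrite ltr0n card_gt0 => /set0Pn[w wC]; apply/hasP; exists w; rewrite ?mem_index_enum.
by rewrite ltNge; apply/negP => le; apply: noC; exists w.
Qed.

(** A set [U] that fails to expand fits, together with its outer neighbours, into a set [S] of size
    [3 * #|U|], for which [3 * k0 <= n] leaves room. The resulting closed pair has exponent zero,
    hence weight one. *)
Lemma potential_expander M r : 3 * k0 <= n%:R -> (forall v, (d <= r v)%N) ->
  potential M r < 1 -> expander k0 (graph_of M).
Proof.
move=> k0n rd pot; apply/forallP => U; apply/implyP => Uk.
rewrite leqNgt; apply/negP => nbU; move: pot; apply/negP; rewrite -leNgt.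
have U0 : (0 < #|U|)%N by move: nbU; case: #|U|.
set N := nbhd_set _ U in nbU.
have U3 : (3 * #|U| <= n)%N.
  by rewrite -(ler_nat R) natrM (le_trans _ k0n)// ler_pM2l.
have [S NUS /eqP S3] : exists2 S : {set V}, N :|: U \subset S & #|S| == (3 * #|U|)%N.
  have NU3 : (#|N :|: U| <= 3 * #|U|)%N.
    by apply: leq_trans (leq_card_setU _ _) _; lia.
  have [||S [NUS _ cS]] := @ex_card_between _ (N :|: U) [set: V] (3 * #|U|).
  - exact: finset.subsetT.
  - by rewrite NU3 cardsT card_ord.
  - by exists S => //; apply/eqP.
have sP : small_pair (U, S) by rewrite /small_pair /= U0 Uk S3 eqxx.
rewrite /potential (bigD1 (U, S))//= {1}/pair_weight /= big1 => [|u _]; last first.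
  by apply/eqP; rewrite subn_eq0.
rewrite expr0 mulr1 (_ : closed_pair M (U, S)).
  by rewrite lerDl sumr_ge0// => P _; rewrite mulr_ge0// exprn_ge0// hit_prob_ge0.
apply/forall_inP => u /= uU; apply/forallP => w; apply/implyP => guw.
apply: (fintype.subsetP NUS); rewrite !inE; case: (boolP (w \in U)) => //= wU.
by rewrite orbF; apply/existsP; exists u; rewrite uU.
Qed.

End Potential.

(** * The potential of the empty graph *)

Section PotentialInit.
Local Open Scope set_scope.
Variables (R : realType).

Lemma bin_le_pow m j : (0 < j)%N -> ('C(m, j)%:R : R) <= ((4 * m)%:R / j%:R) ^+ j.
Proof.
move=> j0; rewrite expr_div_n ler_pdivlMr ?exprn_gt0 ?ltr0n//.
by rewrite -!natrX -natrM ler_nat bin_exp_le.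
Qed.

Lemma sum_half_pow m :
  \sum_(j < m.+1 | (0 < j)%N) (2^-1 : R) ^+ j = 1 - 2^-1 ^+ m.
Proof.
elim: m => [|m IH]; first by rewrite big_mkcond big_ord1 expr0 subrr.
move: IH; rewrite big_mkcond [in X in _ -> X]big_mkcond => IH.
by rewrite big_ord_recr/= IH exprS; lra.
Qed.

(** The two binomials cost four powers of [n / j] and the eight treatments return eight powers of
    [j / (delta * n)]. Since [j <= delta ^ 5 * n], the base is at most [4 ^ 4 * 3 ^ 5 * delta ^ 12],
    which is below one half. *)
Lemma bin_hit_prob_le n j (delta : R) : 0 < delta <= 10^-1 -> (0 < n)%N ->
  (0 < j)%N -> j%:R <= delta ^+ 5 * n%:R ->
  'C(n, j)%:R * ('C(n, 3 * j)%:R * hit_prob n delta j ^+ (8 * j)) <= 2^-1 ^+ j.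
Proof.
move=> /andP[d0 d1] n0 j0 jn.
have j3 : (0 < 3 * j)%N by rewrite muln_gt0.
have jR : 0 < j%:R :> R by rewrite ltr0n.
have nR : 0 < n%:R :> R by rewrite ltr0n.
have h0 : 0 <= hit_prob n delta j by rewrite divr_ge0// mulr_ge0// ltW.
apply: (@le_trans _ _ (((4 * n)%:R / j%:R) ^+ j *
    (((4 * n)%:R / (3 * j)%:R) ^+ (3 * j) * hit_prob n delta j ^+ (8 * j)))).
  apply: ler_pM => //; rewrite ?mulr_ge0 ?exprn_ge0//; first exact: bin_le_pow.
  by rewrite ler_wpM2r ?exprn_ge0// bin_le_pow.
rewrite !exprM -!exprMn lerXn2r// ?nnegrE ?invr_ge0//.
  apply: mulr_ge0; first exact: divr_ge0.
  by apply: mulr_ge0; apply: exprn_ge0 => //; exact: divr_ge0.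
have -> : (4 * n)%:R / j%:R * (((4 * n)%:R / (3 * j)%:R) ^+ 3 *
    hit_prob n delta j ^+ 8) = 4 ^+ 4 * 3 ^+ 5 * (j%:R / n%:R) ^+ 4 / delta ^+ 8.
  by rewrite /hit_prob !natrM; field; rewrite !gt_eqF.
apply: (@le_trans _ _ (4 ^+ 4 * 3 ^+ 5 * (delta ^+ 5) ^+ 4 / delta ^+ 8)).
  rewrite ler_pM2r ?invr_gt0 ?exprn_gt0// ler_pM2l// lerXn2r ?nnegrE ?divr_ge0//.
    by rewrite exprn_ge0// ltW.
  by rewrite ler_pdivrMr.
rewrite (_ : _ / _ = 4 ^+ 4 * 3 ^+ 5 * delta ^+ 12); last by field; rewrite gt_eqF.
have : delta ^+ 12 <= 10^-1 ^+ 12 by rewrite lerXn2r// nnegrE ?invr_ge0// ltW.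
have : (10^-1 : R) ^+ 12 <= 10^-1 ^+ 6.
  by apply: ler_wiXn2l => //; lra.
lra.
Qed.

(** Bounding closedness by one, the pairs with [#|U| = j] contribute at most [2 ^ -j], and the
    geometric series from [j = 1] to [n] stays below one. *)
Lemma potential_init n (delta : R) : 0 < delta <= 10^-1 -> (0 < n)%N ->
  potential 8 delta (delta ^+ 5 * n%:R) (finset.set0 : {set Kn_edge n}) (fun=> 0%N) < 1.
Proof.
move=> d01 n0; have d0 : 0 < delta by case/andP: d01.
have h0 j : 0 <= hit_prob n delta j by rewrite divr_ge0// mulr_ge0// ltW.
apply: (@le_lt_trans _ _ (\sum_(j < n.+1 | (0 < j)%N) (2^-1 : R) ^+ j)); last first.
  by rewrite sum_half_pow ltrBlDr ltrDl exprn_gt0// invr_gt0.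
pose F (U : {set 'I_n}) : R := 'C(n, 3 * #|U|)%:R * hit_prob n delta #|U| ^+ (8 * #|U|).
pose Q (U : {set 'I_n}) := (0 < #|U|)%N && (#|U|%:R <= delta ^+ 5 * n%:R).
apply: (@le_trans _ _ (\sum_(U | Q U) F U)).
  rewrite /potential.
  rewrite (eq_bigl (fun P : {set 'I_n} * {set 'I_n} => Q P.1 && (#|P.2| == 3 * #|P.1|)%N)); last first.
    by move=> P; rewrite /small_pair /Q andbA.
  rewrite -(pair_big_dep Q (fun U (S : {set 'I_n}) => #|S| == 3 * #|U|)%N
    (fun U S => pair_weight 8 delta finset.set0 (fun=> 0%N) (U, S)))/=.
  apply: ler_sum => U _.
  apply: (@le_trans _ _ (\sum_(S : {set 'I_n} | (#|S| == 3 * #|U|)%N)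
      hit_prob n delta #|U| ^+ (8 * #|U|))).
    apply: ler_sum => S _; rewrite /pair_weight /= sum_nat_const mulnC.
    by case: closed_pair; rewrite ?mul1r// mul0r exprn_ge0.
  rewrite sumr_const -[_ *+ _]mulr_natl (_ : #|_| = 'C(n, 3 * #|U|))//.
  by have := card_draws 'I_n (3 * #|U|); rewrite card_ord cardsE.
(* Sizes never exceed [n], so [inord] is faithful and the partition by size is exact. *)
have ordU (U : {set 'I_n}) : (inord #|U| : 'I_n.+1) = #|U| :> nat.
  by rewrite inordK// ltnS -[leqRHS]card_ord max_card.
rewrite (partition_big (fun U : {set 'I_n} => inord #|U| : 'I_n.+1)
  (fun j : 'I_n.+1 => 0 < j)%N) => [|U /andP[]]; last by rewrite ordU.
apply: ler_sum => j j0.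
have [jn|jn] := leP (j%:R : R) (delta ^+ 5 * n%:R); last first.
  rewrite big1 ?exprn_ge0 ?invr_ge0// => U /andP[/andP[_ Un] /eqP Uj].
  by move: jn; rewrite -Uj ordU ltNge Un.
apply: le_trans (bin_hit_prob_le d01 n0 j0 jn).
apply: (@le_trans _ _ (\sum_(U : {set 'I_n} | #|U| == j)
    ('C(n, 3 * j)%:R * hit_prob n delta j ^+ (8 * j)))).
  apply: (@le_trans _ _ (\sum_(U | Q U && (inord #|U| == j))
    ('C(n, 3 * j)%:R * hit_prob n delta j ^+ (8 * j)))).
    by apply: ler_sum => U /andP[_ /eqP Uj]; rewrite /F -Uj ordU.
  rewrite big_mkcond [leRHS]big_mkcond; apply: ler_sum => U _.
  have -> : (inord #|U| == j) = (#|U| == j) by rewrite -val_eqE/= ordU.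
  by case: (Q U); case: eqP => //= _; rewrite mulr_ge0// exprn_ge0.
rewrite sumr_const -[_ *+ _]mulr_natl (_ : #|_| = 'C(n, j))//.
by have := card_draws 'I_n j; rewrite card_ord cardsE.
Qed.

End PotentialInit.

(** * Deterministic strategies that preserve an invariant, seen as point masses *)

Section PureStrategies.
Local Open Scope set_scope.
Variables (R : realType) (X : finType).
Implicit Types (h : history X) (A B : {set X}) (I : history X -> Prop).

Definition pure_strategy (f : history X -> {set X} -> {set X}) :
  maker_strategy R X := fun h B A => (A == f h B)%:R.

Definition default_move m (free : {set X}) : {set X} :=
  odflt finset.set0 [pick A | legal_move m free A].

(** The fallback keeps the move legal at histories from which the invariant cannot be restored,
    since a strategy must be legal everywhere. *)
Definition keep_inv m I h B : {set X} :=
  odflt (default_move m (unclaimed h :\: B))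
    [pick A | legal_move m (unclaimed h :\: B) A && `[< I (rcons h (B, A)) >]].

Lemma default_move_legal m (free : {set X}) : legal_move m free (default_move m free).
Proof.
rewrite /default_move; case: pickP => // noA.
have [||A [_ Af cA]] := @ex_card_between _ finset.set0 free (minn m #|free|).
- exact: finset.sub0set.
- by rewrite cards0 geq_minr.
- by have := noA A; rewrite /legal_move Af cA eqxx.
Qed.

Lemma keep_inv_legal m I h B : legal_move m (unclaimed h :\: B) (keep_inv m I h B).
Proof.
rewrite /keep_inv; case: pickP => [A /andP[]//|_]; exact: default_move_legal.
Qed.

Lemma keep_invP m I h B :
  (exists2 A, legal_move m (unclaimed h :\: B) A & I (rcons h (B, A))) ->
  I (rcons h (B, keep_inv m I h B)).
Proof.
move=> [A lA IA]; rewrite /keep_inv; case: pickP => [A' /andP[_ /asboolP]//|/(_ A)].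
by rewrite lA; move/asboolPn.
Qed.

Lemma pure_strategyP m f :
  (forall h B, legal_move m (unclaimed h :\: B) (f h B)) ->
  is_maker_strategy m (pure_strategy f).
Proof.
move=> fl h B; split=> [A|A nA|]; rewrite /pure_strategy //.
- by case: eqP => // Af; rewrite Af fl in nA.
- by rewrite (bigD1 (f h B))//= eqxx big1 ?addr0// => A /negPf ->.
Qed.

Lemma play_prob_pure f (beta : breaker_strategy X) I T (E : pred (history X)) :
  (forall h, I h -> I (rcons h (beta h, f h (beta h)))) ->
  (forall h, I h -> size h = T -> E h) ->
  forall t h, I h -> (size h + t)%N = T ->
  play_prob (pure_strategy f) beta t h E = 1.
Proof.
move=> Istep IE; elim=> [|t IH] h Ih; first by rewrite addn0 => /IE /= ->.
rewrite addnS -addSn => hT /=.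
rewrite (bigD1 (f h (beta h)))//= {1}/pure_strategy eqxx mul1r big1 ?addr0.
  by apply: IH; [exact: Istep|rewrite size_rcons].
by move=> A /negPf Af; rewrite /pure_strategy Af mul0r.
Qed.

End PureStrategies.

(** * Maker's move and the invariant of the whole game *)

Section Play.
Local Open Scope set_scope.
Variables (R : realType) (n d k a : nat) (beta c p k0 : R).
Hypotheses (beta_ge0 : 0 <= beta) (c_ge0 : 0 <= c) (k_gt0 : (0 < k)%N)
  (kn : (k <= n)%N) (ac : beta * a%:R <= k%:R * c) (p_gt0 : 0 < p).
Hypothesis deg_small :
  touch_bound n k beta c 1 + beta * a%:R + 2 * beta * d%:R + 1 <= (1 - p) * n%:R.
Local Notation V := 'I_n.
Local Notation E := (Kn_edge n).
Implicit Types (M B A : {set E}) (r : V -> nat).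

Let n_gt0 : (0 < n)%N. Proof. exact: leq_trans kn. Qed.

(** The induction is on the number [N] of treatments due rather than on the claims [t], because a
    treatment through an edge that Maker owns uses no claim. *)
Lemma maker_move N t M B r : (t <= a)%N -> (\sum_v (d - r v) = N)%N ->
  danger_ok d k beta c t B r -> potential d p k0 M r < 1 ->
  exists A r', [/\ legal_move t (~: (B :|: M)) A, danger_ok d k beta c 0 B r',
    potential d p k0 (M :|: A) r' < 1 & (\sum_v (d - r' v) <= N - t)%N].
Proof.
elim: N t M r => [|N IH] [|t] M r ta rN ok pot.
- exists finset.set0, r; rewrite finset.setU0 rN; split=> //.
  by rewrite /legal_move finset.sub0set cards0 min0n.
- exists (default_move t.+1 (~: (B :|: M))), r; rewrite rN; split=> //.
  + exact: default_move_legal.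
  (* With no treatment due there is no active vertex, so the danger condition is vacuous and the
     remaining claims are arbitrary. *)
  + move=> J; rewrite card_gt0 => /finset.set0Pn[v vJ] /fintype.subsetP/(_ _ vJ).
    rewrite inE -subn_gt0; move/eqP: rN; rewrite sum_nat_eq0 => /forallP/(_ v)/=.
    by move/eqP ->.
  + apply: le_lt_trans pot; apply: potentialS => //; exact: finset.subsetUl.
- exists finset.set0, r; rewrite finset.setU0 rN; split=> //.
  by rewrite /legal_move finset.sub0set cards0 min0n.
have [v0 v0r] : exists v, v \in active d r.
  apply: contrapT => noact; move: rN; rewrite big1// => v _.
  by apply/eqP; rewrite subn_eq0 leqNgt; apply/negP => rv; apply: noact; exists v; rewrite inE.
case: (@arg_maxP _ _ _ v0 (mem (active d r)) (danger beta B r) v0r) => x act_x xmax.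
have xr : x \in active d r by [].
have rx : (r x < d)%N by move: xr; rewrite inE.
(* The summand 1 in [deg_small] accounts for [x] itself, which is not among its non-neighbours. *)
have Cn : p * n%:R <= #|non_nbrs B x|%:R :> R.
  have := danger_ok_deg beta_ge0 k_gt0 ta xr ok.
  have := card_non_nbrs B x; rewrite -(ler_nat R) !natrD.
  have := deg_small; lra.
have [w] := potential_step k0 p_gt0 n_gt0 M rx Cn.
rewrite inE => /andP[wx nBw] potw.
have [|e ew] := @edge_of_pair n x w; first by rewrite eq_sym.
have addE : claim_pair M x w = M :|: [set e].
  by congr (_ :|: _); apply/finset.setP => f; rewrite !inE -ew; apply/eqP/eqP => [/val_inj|->].
rewrite addE in potw.
have eB : e \notin B.
  by apply: contra nBw => eB; apply/imsetP; exists e.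
have rN' : (\sum_v (d - treat r x v) = N)%N.
  move: rN; rewrite (bigD1 x)//= => rN.
  rewrite (bigD1 x)//= /treat eqxx (eq_bigr (fun v => d - r v)%N) => [|v /negPf ->].
    by move: rN rx; rewrite addn1; move: (\sum_(v | _) _)%N => s; clear; lia.
  by rewrite addn0.
(* An owned edge leaves all [t.+1] claims available; otherwise [e] is the first of them. *)
have [eM|eM] := boolP (e \in M).
  have ME : M :|: [set e] = M by apply/finset.setUidPl; rewrite finset.sub1set.
  rewrite ME in potw.
  have [A [r' [lA ok' pot' r'N]]] := IH t.+1 M (treat r x) ta rN'
    (danger_ok_free_treat beta_ge0 ok) (le_lt_trans potw pot).
  by exists A, r'; split=> //; move: r'N; clear; lia.
have ok1 : danger_ok d k beta c t B (treat r x).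
  apply: danger_ok_treat ok => //; apply: le_trans ac.
  by rewrite ler_wpM2l// ler_nat.
have [A [r' [/andP[Afree /eqP cA] ok' pot' r'N]]] :=
  IH t _ _ (ltnW ta) rN' ok1 (le_lt_trans potw pot).
exists (e |: A), r'; split=> //; last first.
  by rewrite finset.setUA.
set F := ~: (B :|: M).
have FE : ~: (B :|: (M :|: [set e])) = F :\ e.
  by apply/finset.setP => f; rewrite !inE; case: (f \in B); case: (f \in M); case: eqP.
have eF : e \in F by rewrite !inE negb_or eB.
rewrite FE in Afree cA; have eA : e \notin A.
  by apply/negP => /(fintype.subsetP Afree); rewrite !inE eqxx.
rewrite /legal_move cardsU1 eA cA finset.subUset finset.sub1set eF /=.
rewrite (fintype.subset_trans Afree) ?finset.subsetDl//=.
by rewrite [in eqbRHS](cardsD1 e F) eF minnSS.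
Qed.

Definition breaker_claimed (h : history E) : {set E} := \bigcup_(m <- h) m.1.

Lemma unclaimedE h : unclaimed h = ~: (breaker_claimed h :|: maker_claimed h).
Proof. by rewrite /unclaimed big_split. Qed.

(* The truncated subtraction makes the last clause say that all treatments are
   done once [a * size h] reaches [d * n]. *)
Definition maker_inv (h : history E) : Prop :=
  exists r, [/\ danger_ok d k beta c 0 (breaker_claimed h) r,
    potential d p k0 (maker_claimed h) r < 1
    & (\sum_v (d - r v) <= d * n - a * size h)%N].

Lemma maker_inv_step h B : #|B|%:R <= beta * a%:R -> maker_inv h ->
  exists2 A, legal_move a (unclaimed h :\: B) A & maker_inv (rcons h (B, A)).
Proof.
move=> Ba [r [ok pot rn]].
have [A [r' [lA ok' pot' r'n]]] := maker_move (leqnn a) erefl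
  (danger_ok_breaker Ba ok) pot.
exists A.
  rewrite unclaimedE (_ : _ :\: B = ~: (breaker_claimed h :|: B :|: maker_claimed h))//.
  by apply/finset.setP => f; rewrite !inE; case: (f \in B); rewrite ?orbT ?orbF.
exists r'; rewrite /breaker_claimed /maker_claimed -cats1 !big_cat !big_seq1/=.
split=> //; rewrite size_cat/=; apply: leq_trans r'n _; move: rn; clear; lia.
Qed.

Lemma maker_inv0 :
  potential d p k0 (finset.set0 : {set E}) (fun=> 0%N) < 1 -> maker_inv [::].
Proof.
move=> pot; exists (fun=> 0%N); rewrite /breaker_claimed /maker_claimed !big_nil.
split=> //; first exact: danger_ok0.
by rewrite muln0 subn0 sum_nat_const card_ord subn0 mulnC.
Qed.

Lemma maker_inv_expander h T : 3 * k0 <= n%:R -> (d * n <= a * T)%N ->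
  maker_inv h -> size h = T -> maker_expander_by k0 T h.
Proof.
(* The witness [ord_max] is the position after all [T] moves, when no treatment is due. *)
move=> k0n dT [r [_ pot rn]] hT; apply/existsP; exists ord_max.
rewrite /= -hT take_size; apply: potential_expander pot => // v.
have : (\sum_v (d - r v) == 0)%N.
  by rewrite -leqn0 (leq_trans rn)// hT leqn0 subn_eq0.
by rewrite sum_nat_eq0 => /forallP/(_ v)/=; rewrite subn_eq0.
Qed.

Lemma play_wins b (bs : breaker_strategy E) T : b%:R <= beta * a%:R ->
  is_breaker_strategy b bs -> 3 * k0 <= n%:R -> (d * n <= a * T)%N ->
  potential d p k0 (finset.set0 : {set E}) (fun=> 0%N) < 1 ->
  play_prob (pure_strategy R (keep_inv a maker_inv)) bs T [::]
    (maker_expander_by k0 T) = 1.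
Proof.
move=> ba bsP k0n dT pot; apply: (@play_prob_pure _ _ _ _ maker_inv T).
- move=> h hI; apply: keep_invP; apply: maker_inv_step => //.
  have /andP[_ /eqP ->] := bsP h; apply: le_trans ba.
  by rewrite ler_nat geq_minl.
- by move=> h hI hT; exact: maker_inv_expander.
- exact: maker_inv0.
- by [].
Qed.

End Play.

(** Eight treatments per vertex need [8 * n] claims. The factor two up to [16 * n] absorbs the
    rounding when [a <= 8 * n]; for larger [a] a single move suffices. *)
Lemma move_bound_ge n a : (0 < a)%N -> (8 * n <= a * move_bound n a)%N.
Proof.
move=> a0; rewrite /move_bound; have [an|an] := leqP a (8 * n).
  have := leq_trunc_div (16 * n) a; have := divn_eq (16 * n) a.
  have := ltn_pmod (16 * n) a0; set q := (_ %/ a)%N; set m := (_ %% a)%N => ma qE _.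
  apply: (@leq_trans (a * q)); last by rewrite leq_mul2l leq_maxr orbT.
  by move: an qE ma; clear; lia.
apply: (@leq_trans (a * 1)); last by rewrite leq_mul2l leq_maxl orbT.
by rewrite muln1 ltnW.
Qed.

(** * Harmonic numbers, logarithms and the size of the bias *)

Section Asymptotics.
Variable R : realType.
Implicit Types (n : nat) (M kappa : R).

Lemma ln_harm_le m : ln m.+1%:R <= harm R m.
Proof.
elim: m => [|m IH]; first by rewrite ln1 /harm big_ord0.
have m1 : 0 < m.+1%:R :> R by rewrite ltr0n.
rewrite harmS; have -> : m.+2%:R = m.+1%:R * (1 + m.+1%:R^-1) :> R.
  by rewrite mulrDr mulr1 divff ?gt_eqF// natr1.
have i1 : 0 < m.+1%:R^-1 :> R by rewrite invr_gt0.
rewrite lnM ?posrE ?addr_gt0// lerD// le_ln1Dx// (lt_trans _ i1)// ltrN10.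
Qed.

Lemma harm_le_ln n : (0 < n)%N -> harm R n <= 1 + ln n%:R.
Proof.
case: n => // m _; elim: m => [|m IH].
  by rewrite harmS /harm big_ord0 ln1 invr1 addr0 add0r.
have m2 : 0 < m.+2%:R :> R by rewrite ltr0n.
have m2' : m.+2%:R != 0 :> R by rewrite gt_eqF.
have i1 : m.+2%:R^-1 < 1 :> R by rewrite invf_lt1// ltr1n.
have E : m.+1%:R = m.+2%:R * (1 - m.+2%:R^-1) :> R.
  by rewrite mulrBr mulr1 divff// -[m.+2%:R]natr1 addrK.
rewrite harmS; have : ln m.+1%:R <= ln m.+2%:R - m.+2%:R^-1 :> R.
  by rewrite E lnM ?posrE ?subr_gt0// lerD2l le_ln1Dx// ltrN2.
by rewrite lerBrDr => h; rewrite (le_trans (lerD IH (lexx _)))// -addrA lerD2l.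
Qed.

(** The cube serves the case of large [a]: there [n / ln n] must exceed a multiple of [ln n ^ 2] for
    its square root to exceed a multiple of [ln n]. *)
Lemma ln_large M : \forall n \near \oo,
  [/\ (0 < n)%N, M <= ln n%:R & M * ln n%:R ^+ 3 <= n%:R].
Proof.
near=> n; have n0 : (0 < n)%N by near: n; exact: nbhs_infty_gt.
have nR : 0 < n%:R :> R by rewrite ltr0n.
have Ln : `|24 * M| <= ln n%:R.
  rewrite -[leLHS]expRK ler_ln ?posrE ?expR_gt0//; near: n; exact: nbhs_infty_ger.
have M24 : 24 * M <= ln n%:R by apply: le_trans Ln; exact: ler_norm.
have L0 : 0 <= ln n%:R :> R by apply: le_trans Ln.
split=> //.
  by have [M0|M0] := leP 0 M; lra.
(* The degree 4 term of the exponential series gives [L ^ 4 / 24 <= n], hence the threshold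
   [24 * M]. *)
have := expR_ge1Dxn 3 L0; rewrite lnK ?posrE//.
rewrite (_ : 4`! = 24)//; set L := ln _ in L0 M24 *.
have : 24 * M * L ^+ 3 <= L * L ^+ 3 by rewrite ler_wpM2r ?exprn_ge0.
rewrite -exprS; lra.
Unshelve. all: by end_near. Qed.

(** The quantity [b / a * ln n + b] equals [b * (a + ln n) / a], which is [(1 - eps) * n] up to a
    rounding error of at most [1 + ln n]. Dividing by [ln n] bounds [b / a]. *)
Lemma bias_bound_small_a (eps : R) (a b : nat -> nat) kappa :
  0 < eps < 1 -> 0 < kappa -> (forall n, (0 < a n)%N) ->
  (forall n, rounding_of (b n)
     ((1 - eps) * ((a n)%:R * n%:R / ((a n)%:R + ln n%:R)))) ->
  \forall n \near \oo, (b n)%:R / (a n)%:R <= kappa * n%:R /\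
    (b n)%:R / (a n)%:R * ln n%:R + (b n)%:R <= (1 - eps) * n%:R + kappa * n%:R.
Proof.
move=> /andP[e0 e1] k0 a0 bE.
near=> n.
have [n0 nL nL3] : [/\ (0 < n)%N, 2 + 2 / kappa <= ln n%:R &
    (2 + 2 / kappa) * ln n%:R ^+ 3 <= n%:R] by near: n; exact: ln_large.
have /andP[_] := bE n; have a1 : 1 <= (a n)%:R :> R by rewrite ler1n.
set A : R := (a n)%:R in a1 *; set L : R := ln n%:R in nL nL3 *.
set N : R := n%:R in nL3 *; set b' : R := (b n)%:R => bL.
have k20 : 0 < 2 / kappa by rewrite divr_gt0.
have L2 : 2 <= L by lra.
have A0 : 0 < A by lra.
have LN : (2 / kappa) * L <= N.
  apply: le_trans nL3; apply: ler_pM; [lra|lra|lra|].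
  by rewrite -[leLHS]expr1; apply: ler_weXn2l => //; lra.
have kL : 2 * L <= kappa * N.
  have := ler_wpM2l (ltW k0) LN; rewrite mulrA mulrCA divff ?gt_eqF//; lra.
have N0 : 0 < N by rewrite ltr0n.
have N2 : 2 / kappa * N <= L * N by rewrite ler_pM2r//; lra.
have b1 : b' / A * (A + L) <= (1 - eps) * N + (A + L) / A.
  have := ltW bL; rewrite -(@ler_pM2r _ ((A + L) / A)); last by rewrite divr_gt0//; lra.
  rewrite [leRHS](_ : _ = (1 - eps) * N + (A + L) / A); last by field; lra.
  by rewrite [leLHS](_ : _ = b' / A * (A + L))//; field; lra.
have AL : (A + L) / A <= 1 + L.
  rewrite ler_pdivrMr// mulrDl mul1r lerD2l; nra.
split; last first.
  have : b' / A * (A + L) = b' / A * L + b' by field; lra.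
  lra.
rewrite -(@ler_pM2r _ L); last lra.
have : b' / A * L <= b' / A * (A + L).
  by rewrite ler_wpM2l// ?divr_ge0 ?ler0n//; lra.
have : (2 / kappa * N) * kappa <= L * N * kappa by rewrite ler_pM2r.
rewrite [2 / kappa * N * kappa](_ : _ = 2 * N); last by field; lra.
have : (1 - eps) * N <= N by rewrite ler_piMl//; lra.
have : kappa * N * 2 <= kappa * N * L by rewrite ler_wpM2l// mulr_ge0// ltW.
lra.
Unshelve. all: by end_near. Qed.

Lemma bias_bound_large_a (eps : R) (a b : nat -> nat) kappa :
  0 < eps < 1 -> 0 < kappa -> (forall n, (0 < a n)%N) ->
  (fun n => (a n)%:R : R) \is 'Omega_\oo (fun n => Num.sqrt (n%:R / ln n%:R) : R) ->
  (forall n, rounding_of (b n) ((1 - eps) * n%:R)) ->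
  \forall n \near \oo, (b n)%:R / (a n)%:R <= kappa * n%:R /\
    (b n)%:R / (a n)%:R * ln n%:R + (b n)%:R <= (1 - eps) * n%:R + kappa * n%:R.
Proof.
move=> /andP[e0 e1] k0 a0; rewrite qualifE => /asboolP[c c0 ca] bE.
(* With this [K], [a >= K * c * ln n] reads [ln n / a <= kappa / 4]; as [b <= 2 * n], the
   logarithmic term is at most [kappa * n / 2]. *)
pose K := 4 / (kappa * c).
have K0 : 0 < K by rewrite divr_gt0// mulr_gt0.
near=> n.
have [n0 nL nL3] : [/\ (0 < n)%N, 1 + K ^+ 2 + 2 / kappa <= ln n%:R &
    (1 + K ^+ 2 + 2 / kappa) * ln n%:R ^+ 3 <= n%:R] by near: n; exact: ln_large.
have : c * `|Num.sqrt (n%:R / ln n%:R) : R| <= `|(a n)%:R : R| by near: n; exact: ca.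
rewrite ger0_norm ?sqrtr_ge0// ger0_norm//.
have /andP[_] := bE n; have a1 : 1 <= (a n)%:R :> R by rewrite ler1n.
set A : R := (a n)%:R in a1 *; set L : R := ln n%:R in nL nL3 *.
set N : R := n%:R in nL3 *; set b' : R := (b n)%:R => bL cA.
have k20 : 0 < 2 / kappa by rewrite divr_gt0.
have K2 : 0 < K ^+ 2 by rewrite exprn_gt0.
have L1 : 1 <= L by lra.
have L30 : 1 <= L ^+ 3 by rewrite exprn_ege1.
have N1 : 1 <= N by rewrite ler1n.
have kN : 2 <= kappa * N.
  have : 2 / kappa <= N by nra.
  by rewrite ler_pdivrMr// mulrC.
have KL : K ^+ 2 * L ^+ 3 <= N by nra.
have KLA : K * L * c <= A.
  apply: le_trans cA; rewrite mulrC ler_pM2l//.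
  have KL0 : 0 <= K * L by rewrite mulr_ge0//; lra.
  rewrite -[leLHS]ger0_norm// -sqrtr_sqr ler_wsqrtr// ler_pdivlMr; last lra.
  by apply: le_trans KL; rewrite exprMn -mulrA -exprSr.
have LA : L / A <= kappa / 4.
  rewrite ler_pdivrMr; last lra.
  have -> : L = kappa / 4 * (K * L * c) by rewrite /K; field; rewrite !gt_eqF.
  by rewrite ler_wpM2l// divr_ge0// ltW.
have b0 : 0 <= b' by rewrite ler0n.
have eN : (1 - eps) * N <= N by rewrite ler_piMl//; lra.
have b2N : b' <= 2 * N by lra.
have bLA : b' / A * L <= kappa * N / 2.
  rewrite -mulrA [A^-1 * L]mulrC; apply: (@le_trans _ _ (2 * N * (kappa / 4))); last lra.
  by apply: ler_pM => //; rewrite divr_ge0//; lra.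
have bA : b' / A <= b' / A * L by rewrite ler_peMr// divr_ge0//; lra.
by split; lra.
Unshelve. all: by end_near. Qed.

End Asymptotics.

(** For [k] near [eta * n], [2 * harm n - harm k] is at most [ln n] plus a constant, so the leading
    terms are [beta * ln n + b]. Of the slack [2 * eta * n] between [eps] and [delta], [k] takes at
    most half, and three errors of [eta / 4 * n] each fit into the rest. *)
Lemma touch_bound_small (R : realType) (eps delta eta : R) (a b : nat -> nat) :
  0 < eps < 1 -> 0 < eta -> eta < 1 -> delta = eps - 2 * eta ->
  (forall n, (0 < a n)%N) ->
  (forall kappa : R, 0 < kappa -> \forall n \near \oo,
    (b n)%:R / (a n)%:R <= kappa * n%:R /\
    (b n)%:R / (a n)%:R * ln n%:R + (b n)%:R <= (1 - eps) * n%:R + kappa * n%:R) ->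
  \forall n \near \oo, let k := Num.truncn (eta * n%:R) in
    let beta : R := (b n)%:R / (a n)%:R in
    [/\ (0 < k)%N, (k <= n)%N &
      touch_bound n k beta ((b n)%:R / k%:R) 1 + beta * (a n)%:R + 2 * beta * 8%:R + 1
        <= (1 - delta) * n%:R].
Proof.
move=> /andP[e0 e1] eta0 eta1 dE a0 H.
(* Here 16 comes from [2 * beta * 8], and [2 + |ln eta|] from the harmonic numbers. *)
pose C := 18 + `|ln eta|.
have C0 : 0 < C by rewrite ltr_wpDr.
have k10 : 0 < eta / 4 / C by rewrite !divr_gt0.
have k20 : 0 < eta / 4 by rewrite divr_gt0.
near=> n; have n0 : (0 < n)%N by near: n; exact: nbhs_infty_gt.
have [bC _] : (b n)%:R / (a n)%:R <= eta / 4 / C * n%:R /\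
    (b n)%:R / (a n)%:R * ln n%:R + (b n)%:R <= (1 - eps) * n%:R + eta / 4 / C * n%:R
  by near: n; exact: H.
have [_ bL] : (b n)%:R / (a n)%:R <= eta / 4 * n%:R /\
    (b n)%:R / (a n)%:R * ln n%:R + (b n)%:R <= (1 - eps) * n%:R + eta / 4 * n%:R
  by near: n; exact: H.
(* The two summands ensure [2 <= eta * n] and [4 / eta + 1 <= eta / 4 * n], where [4 / eta] bounds
   [b / k]. *)
have nbig : (2 / eta) + (4 / eta + 1) / (eta / 4) <= n%:R by near: n; exact: nbhs_infty_ger.
have A0 : 0 < (a n)%:R :> R by rewrite ltr0n.
set k := Num.truncn _; set beta := (b n)%:R / (a n)%:R.
have N0 : 0 < n%:R :> R by rewrite ltr0n.
have b0 : 0 <= beta by rewrite divr_ge0.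
have p1 : 0 < 2 / eta by rewrite divr_gt0.
have p2 : 0 < (4 / eta + 1) / (eta / 4) by rewrite !divr_gt0// addr_gt0// divr_gt0.
have etan : 2 <= eta * n%:R.
  by rewrite [leRHS]mulrC -ler_pdivrMr// (le_trans _ nbig)// lerDl ltW.
have etan2 : 4 / eta + 1 <= eta / 4 * n%:R.
  by rewrite [leRHS]mulrC -ler_pdivrMr// (le_trans _ nbig)// lerDr ltW.
have /andP[kle klt] : k%:R <= eta * n%:R < k.+1%:R.
  by apply: truncn_itv; rewrite mulr_ge0// ltW.
have kR : 1 <= k%:R :> R by move: klt; rewrite -natr1; lra.
have k0 : (0 < k)%N by rewrite -(ler_nat R).
have kn : (k <= n)%N by rewrite -(ler_nat R) (le_trans kle)// ler_piMl// ltW.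
split; [exact: k0|exact: kn|].
have ba : beta * (a n)%:R = (b n)%:R by rewrite divfK// gt_eqF.
have Hn := harm_le_ln R n0; have Hk := ln_harm_le R k.
have lnk : ln eta + ln n%:R <= ln k.+1%:R.
  by rewrite -lnM ?posrE// ler_ln ?posrE ?ltr0n ?mulr_gt0// ltW.
have bL0 : 0 <= beta * ln n%:R by rewrite mulr_ge0// ln_ge0// ler1n.
have b2n : (b n)%:R <= 2 * n%:R :> R.
  have : 0 <= eps * n%:R by rewrite mulr_ge0// ltW.
  have : eta * n%:R <= n%:R by rewrite ler_piMl// ltW.
  rewrite -/beta in bL; lra.
have bk : (b n)%:R / k%:R <= 4 / eta.
  rewrite ler_pdivrMr ?ltr0n// mulrAC ler_pdivlMr//.
  have : (b n)%:R * eta <= 2 * n%:R * eta by rewrite ler_wpM2r// ltW.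
  move: klt; rewrite -natr1; lra.
have etaN : - ln eta <= `|ln eta| by rewrite -normrN ler_norm.
have bH : beta * (2 * harm R n - harm R k) <= beta * (2 + ln n%:R + `|ln eta|).
  by rewrite ler_wpM2l//; lra.
have bCn : beta * C <= eta / 4 * n%:R.
  have := ler_wpM2r (ltW C0) bC; rewrite -/beta.
  by rewrite [leRHS](_ : _ = eta / 4 * n%:R)//; field; rewrite gt_eqF.
have h1 : harm R 1 = 1 by rewrite /harm big_ord1 invr1.
rewrite /touch_bound h1 ba dE mul1r.
rewrite -/beta in bL; rewrite /C in bCn.
lra.
Unshelve. all: by end_near. Qed.

(** * Choice of the parameters and the limit of the winning probability *)

Theorem lemma19 (R : realType) (eps delta : R) (a b : nat -> nat)
  (heps : 0 < eps < 1)
  (ha : forall n, (0 < a n)%N)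
  (hab :
    ((fun n => (a n)%:R : R) =o_\oo (fun n => Num.sqrt (n%:R / ln n%:R) : R)
     /\ forall n, rounding_of (b n)
          ((1 - eps) * ((a n)%:R * n%:R / ((a n)%:R + ln n%:R))))
    \/
    ((fun n => (a n)%:R : R) \is 'Omega_\oo (fun n => Num.sqrt (n%:R / ln n%:R) : R)
     /\ forall n, rounding_of (b n) ((1 - eps) * n%:R)))
  (hdelta : 0 < delta < Num.min eps (2 ^+ 2 / (expR 1 ^+ 7 * 10 ^+ 4))) :
  exists mu : forall n, maker_strategy R (Kn_edge n),
    (forall n, is_maker_strategy (a n) (mu n)) /\
    (forall beta : forall n, breaker_strategy (Kn_edge n),
       (forall n, is_breaker_strategy (b n) (beta n)) ->
       (fun n => play_prob (mu n) (beta n) (move_bound n (a n)) [::]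
                   (maker_expander_by (delta ^+ 5 * n%:R)
                      (move_bound n (a n)))) @ \oo --> (1 : R)).
Proof.
have /andP[d0] := hdelta; rewrite lt_min => /andP[deps dsmall].
have /andP[e0 e1] := heps.
have d1 : delta <= 10^-1.
  apply: le_trans (ltW dsmall) _.
  have : 1 <= expR (1 : R) ^+ 7 by rewrite exprn_ege1// -expR0 ler_expR.
  move=> e7; rewrite ler_pdivrMr; last by rewrite mulr_gt0 ?exprn_gt0 ?expR_gt0.
  lra.
pose eta := (eps - delta) / 2.
have eta0 : 0 < eta by rewrite divr_gt0// subr_gt0.
have eta1 : eta < 1 by rewrite /eta; lra.
have dE : delta = eps - 2 * eta by rewrite /eta; lra.
have small : forall kappa : R, 0 < kappa -> \forall n \near \oo,
    (b n)%:R / (a n)%:R <= kappa * n%:R /\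
    (b n)%:R / (a n)%:R * ln n%:R + (b n)%:R <= (1 - eps) * n%:R + kappa * n%:R.
  move=> kappa kappa0; case: hab => [[_ bE]|[aE bE]].
    exact: bias_bound_small_a.
  exact: bias_bound_large_a.
pose k n := Num.truncn (eta * n%:R).
pose beta n : R := (b n)%:R / (a n)%:R.
(* The value [b / k] for [c] makes [k * c] equal to [beta * a], the full credit of a round. *)
pose inv n := @maker_inv R n 8 (k n) (a n) (beta n) ((b n)%:R / (k n)%:R) delta
  (delta ^+ 5 * n%:R).
exists (fun n => pure_strategy R (keep_inv (a n) (inv n))); split.
  by move=> n; apply: pure_strategyP => h B; exact: keep_inv_legal.
(* The winning probability equals one for all large [n]. *)
move=> bs bsP; apply: cvg_near_cst.
have := touch_bound_small heps eta0 eta1 dE ha small; apply: filterS => n [k0 kn deg].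
have A0 : (a n)%:R != 0 :> R by rewrite pnatr_eq0 -lt0n.
have n0 : (0 < n)%N := leq_trans k0 kn.
apply: (@play_wins R n 8 (k n) (a n) (beta n) _ delta _ _ _ _ _ _ _ _ (b n)) => //.
- by rewrite divr_ge0.
- by rewrite [leRHS]mulrC !divfK// pnatr_eq0 -lt0n.
- by rewrite divfK.
- rewrite mulrA ler_piMl//.
  have : delta ^+ 5 <= 10^-1 ^+ 5 by rewrite lerXn2r// nnegrE ?invr_ge0// ltW.
  lra.
- exact: move_bound_ge.
- by apply: potential_init => //; rewrite d0.
Qed.
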